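(* Let $k$ be a field and let $m\geq 3$ and $0\leq r\leq s\leq m-2$ be integers. Let $f_{m,r,s}\in R=R_{m,r,s}$ be the determinant of the matrix $\mathfrak{G}_{m,r,s}$. Then: (a) If $r\neq s$ then $f_{m,r,s}$ has vanishing Hessian. (b) If $r=s$ then $f_{m,r,r}$ is homaloidal.
   Context: $\mathfrak{G}_{m,r,s}=(g_{i,j})$ is the $m\times m$ matrix with $g_{i,j}=x_{i,j}$ (independent indeterminates over $k$) if $r+2\leq i+j\leq 2m-s$, and $g_{i,j}=0$ otherwise; $R_{m,r,s}$ is the polynomial ring over $k$ in the nonzero entries of $\mathfrak{G}_{m,r,s}$. A form $f$ in a polynomial ring $k[z_1,\ldots,z_N]$ has vanishing Hessian if the determinant of its Hessian matrix $(\partial^2 f/\partial z_a\partial z_b)$ is zero. It is homaloidal if its polar map $\mathbb{P}^{N-1}\dashrightarrow\mathbb{P}^{N-1}$, defined by the partial derivatives $(\partial f/\partial z_1:\cdots:\partial f/\partial z_N)$, is birational. *)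

(* Defs.v *)
From HB Require Import structures.
From mathcomp Require Import all_boot all_order all_algebra.
From mathcomp Require Import mpoly.

Set Implicit Arguments.
Unset Strict Implicit.
Unset Printing Implicit Defensive.

Import GRing.Theory.
Local Open Scope ring_scope.

(* 'I_m is 0-based whereas the indices i, j of the matrix run over 1..m,
   hence the successors. *)
Definition in_band (m r s : nat) (p : 'I_m * 'I_m) : bool :=
  (r + 2 <= p.1.+1 + p.2.+1 <= 2 * m - s)%N.

Definition band_pos (m r s : nat) : finType :=
  {p : 'I_m * 'I_m | in_band r s p}.

Definition nvars (m r s : nat) : nat := #|band_pos m r s|.

(* Positions in the band are numbered by [enum_rank], so that every variable of
   {mpoly k[nvars m r s]} occurs as exactly one entry of [Gmx k m r s]. *)
Definition Gmx (k : fieldType) (m r s : nat) : 'M[{mpoly k[nvars m r s]}]_m :=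
  \matrix_(i, j)
    if insub (i, j) : option (band_pos m r s) is Some e
    then 'X_(enum_rank e) else 0.

Definition fdet (k : fieldType) (m r s : nat) : {mpoly k[nvars m r s]} :=
  \det (Gmx k m r s).

Section Forms.
Variables (k : fieldType) (n : nat).
Implicit Type f : {mpoly k[n]}.

Definition is_form f : Prop := exists d : nat, f \is d.-homog.

Definition hessian f : 'M[{mpoly k[n]}]_n :=
  \matrix_(a, b) f^`M(a)^`M(b).

Definition vanishing_hessian f : Prop := is_form f /\ \det (hessian f) = 0.

End Forms.

(* A rational map P^(n-1) --> P^(p-1) over k is represented by a p-tuple of
   forms of one common degree in n variables, not all zero. *)
Section RationalMaps.
Variable k : fieldType.

Definition nonzero_tuple (n p : nat) (F : p.-tuple {mpoly k[n]}) : Prop :=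
  exists i : 'I_p, tnth F i != 0.

Definition ratmap (n p : nat) (F : p.-tuple {mpoly k[n]}) : Prop :=
  (exists d : nat, forall i : 'I_p, tnth F i \is d.-homog) /\ nonzero_tuple F.

(* Two representatives define the same map when they are proportional over the
   field of fractions. *)
Definition same_ratmap (n p : nat) (F G : p.-tuple {mpoly k[n]}) : Prop :=
  [/\ nonzero_tuple F, nonzero_tuple G
    & forall i j : 'I_p, tnth F i * tnth G j = tnth F j * tnth G i].

Definition id_ratmap (n : nat) : n.-tuple {mpoly k[n]} := [tuple 'X_i | i < n].

(* The map G after F; it is a rational map only if the resulting tuple is not
   identically zero, which [same_ratmap] requires. *)
Definition comp_ratmap (n p q : nat) (G : q.-tuple {mpoly k[p]})
    (F : p.-tuple {mpoly k[n]}) : q.-tuple {mpoly k[n]} :=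
  [tuple tnth G j \mPo F | j < q].

Definition birational (n p : nat) (F : p.-tuple {mpoly k[n]}) : Prop :=
  ratmap F /\
  exists G : n.-tuple {mpoly k[p]},
    [/\ ratmap G,
        same_ratmap (comp_ratmap G F) (id_ratmap n)
      & same_ratmap (comp_ratmap F G) (id_ratmap p)].

Definition polar_map (n : nat) (f : {mpoly k[n]}) : n.-tuple {mpoly k[n]} :=
  [tuple f^`M(i) | i < n].

Definition homaloidal (n : nat) (f : {mpoly k[n]}) : Prop :=
  is_form f /\ birational (polar_map f).

End RationalMaps.

(* Main.v *)
Require Import Defs.
From mathcomp Require Import all_boot all_order all_algebra perm.
From mathcomp Require Import mpoly.
From mathcomp Require Import zify ring.

(** Reversing the columns of the matrix G turns it into a band matrix X, whose
nonzero entries lie on consecutive diagonals around the main one.  Write f for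
det G; then the partial derivative of f with respect to the entry (i, j) is the
cofactor of G at (i, j), because f is affine in each entry of a row with that
cofactor as coefficient ([mderiv_fdet]).  So the polar map sends X, up to a
common sign, to the entries of its transposed adjugate which lie on the band,
and both parts of the theorem are statements about inverses of band matrices.

If r < s, the last column of G is supported on its first m - s rows.  As it is
orthogonal to all cofactor columns but its own, the square block of cofactors
in these rows and in the columns r, ..., r + m - s - 1 is singular, and this
block lies inside the band.  Hence the partial derivatives satisfy the
determinantal relation of that block, and the gradient of the relation is in
the kernel of the Hessian.  The gradient of a determinant at a singular matrix
has rank one, so the kernel vector is written down directly as z_i * w_b, with
z the last column of G and w a vector killed by the block
([corner_minor_kernel], [vanishing_hessian_fdet]).

If r = s, the band is symmetric, |i - j| <= p with p = m - r - 1, and a band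
matrix is determined by the band of its inverse.  Let A be a band matrix with a
factorization A = L D U into triangular factors, and let B be its inverse.
Since B L is upper triangular, the j-th column of L, which is supported on the
window [j, j + p], is a multiple of the first column of the inverse of the
window block of B, that is of (B a b) for a and b in [j, j + p]; and this block
only involves the band of B.  In the same way the rows of U are first rows of
inverses of window blocks, and D is given by the corner entries.  Clearing
denominators gives the polynomial matrix [completion Y] attached to a band Y.
The two composites of this map with matrix inversion are the identity up to a
scalar factor: [completion_inverse] recovers A from its inverse, by showing
that U B L is diagonal; [inverse_completion_near] recovers Y from the inverse of
[completion Y], because Y and that inverse solve the same triangular system,
one window after the other.  All of this is done without denominators in an
integral domain.  The genericity conditions, that certain minors do not vanish,
are checked by specializing X to the identity matrix. *)

Set Implicit Arguments.
Unset Strict Implicit.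
Unset Printing Implicit Defensive.

Import GRing.Theory.
Local Open Scope ring_scope.

(** * Recovering a band matrix from the band of its inverse *)

(** The principal submatrix of A on S, bordered by an identity matrix: it has the
same determinant, and the size does not change with S. *)
Definition padded_block (R : pzRingType) (m : nat) (S : pred 'I_m)
    (A : 'M[R]_m) : 'M[R]_m :=
  \matrix_(a, b) if S a && S b then A a b else (a == b)%:R.

Definition near (m p : nat) (a b : 'I_m) : bool :=
  (a <= b + p)%N && (b <= a + p)%N.

Definition window (m p : nat) (j : 'I_m) : pred 'I_m :=
  fun a => (j <= a <= j + p)%N.

Section Completion.
Variables (m p : nat).

Definition window_block (R : pzRingType) (Y : 'M[R]_m) (j : 'I_m) : 'M[R]_m :=
  padded_block (window p j) Y.

(** The j-th column is proportional to the first column of the inverse of the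
window block at j; it is the j-th column of the lower triangular factor of the
band matrix that has Y as band of its inverse. *)
Definition lower_factor (R : pzRingType) (Y : 'M[R]_m) : 'M[R]_m :=
  \matrix_(a, j) \adj (window_block Y j) a j.

Definition upper_factor (R : pzRingType) (Y : 'M[R]_m) : 'M[R]_m :=
  \matrix_(j, b) \adj (window_block Y j) j b.

Definition pivot (R : pzRingType) (Y : 'M[R]_m) (j : 'I_m) : R :=
  \det (window_block Y j) * \adj (window_block Y j) j j.

Definition pivots (R : pzRingType) (Y : 'M[R]_m) : R := \prod_j pivot Y j.

Definition copivots (R : pzRingType) (Y : 'M[R]_m) : 'rV[R]_m :=
  \row_j \prod_(i | i != j) pivot Y i.

(** The sum over j of (column j of L) (row j of U) / [pivot Y j], multiplied by
[pivots Y] to clear the denominators; it is [pivots Y] times the band matrix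
whose inverse has the band Y. *)
Definition completion (R : pzRingType) (Y : 'M[R]_m) : 'M[R]_m :=
  lower_factor Y *m diag_mx (copivots Y) *m upper_factor Y.

Lemma tr_padded_block (R : pzRingType) (S : pred 'I_m) (A : 'M[R]_m) :
  padded_block S A^T = (padded_block S A)^T.
Proof.
by apply/matrixP => a b; rewrite !mxE andbC eq_sym.
Qed.

Section Transpose.
Variable R : comPzRingType.
Implicit Type Y : 'M[R]_m.

Lemma lower_factor_tr Y : lower_factor Y^T = (upper_factor Y)^T.
Proof.
apply/matrixP => a j.
by rewrite [LHS]mxE [RHS]mxE [RHS]mxE /window_block tr_padded_block -trmx_adj mxE.
Qed.

Lemma upper_factor_tr Y : upper_factor Y^T = (lower_factor Y)^T.
Proof. by rewrite -[Y in RHS]trmxK lower_factor_tr trmxK. Qed.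

Lemma pivot_tr Y j : pivot Y^T j = pivot Y j.
Proof.
by rewrite /pivot /window_block tr_padded_block det_tr -trmx_adj mxE.
Qed.

Lemma pivots_tr Y : pivots Y^T = pivots Y.
Proof. by apply: eq_bigr => j _; rewrite pivot_tr. Qed.

Lemma completion_tr Y : completion Y^T = (completion Y)^T.
Proof.
rewrite /completion !trmx_mul tr_diag_mx lower_factor_tr upper_factor_tr mulmxA.
by congr (_ *m diag_mx _ *m _); apply/rowP => j; rewrite !mxE;
   apply: eq_bigr => i _; rewrite pivot_tr.
Qed.

End Transpose.

Section Map.
Variables (R S : comPzRingType) (g : {rmorphism R -> S}).
Implicit Type Y : 'M[R]_m.

Lemma map_padded_block (P : pred 'I_m) Y :
  map_mx g (padded_block P Y) = padded_block P (map_mx g Y).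
Proof.
by apply/matrixP => a b; rewrite !mxE; case: ifP => // _; rewrite rmorph_nat.
Qed.

Lemma map_adj_window Y j a b :
  g (\adj (window_block Y j) a b) = \adj (window_block (map_mx g Y) j) a b.
Proof. by rewrite /window_block -map_padded_block -map_mx_adj [RHS]mxE. Qed.

Lemma map_pivot Y j : g (pivot Y j) = pivot (map_mx g Y) j.
Proof.
by rewrite rmorphM /= map_adj_window -det_map_mx map_padded_block.
Qed.

Lemma map_completion Y : map_mx g (completion Y) = completion (map_mx g Y).
Proof.
rewrite /completion !map_mxM; congr (_ *m _ *m _).
- by apply/matrixP => a j; rewrite [LHS]mxE [X in g X]mxE map_adj_window [RHS]mxE.
- apply/matrixP => a j; rewrite 5!mxE rmorphMn rmorph_prod.
  by congr (_ *+ _); apply: eq_bigr => i _; rewrite map_pivot.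
- by apply/matrixP => a j; rewrite [LHS]mxE [X in g X]mxE map_adj_window [RHS]mxE.
Qed.

End Map.

Section Solve.
Variable R : idomainType.
Implicit Types Y A B L U T : 'M[R]_m.

Lemma win_self (j : 'I_m) : window p j j.
Proof. by rewrite /window leqnn leq_addr. Qed.

Lemma near_window (i l j : 'I_m) : window p j i -> window p j l -> near p i l.
Proof. rewrite /window /near; lia. Qed.

Lemma nearC (a b : 'I_m) : near p a b = near p b a.
Proof. by rewrite /near andbC. Qed.

(** Outside its window the padded block has unit rows, which transfer to the
adjugate. *)
Lemma lower_factor_out Y (a j : 'I_m) :
  ~~ window p j a -> lower_factor Y a j = 0.
Proof.
move=> Ha; rewrite mxE; have := mul_mx_adj (window_block Y j).
move: (\adj _) (\det _) => D d /(congr1 (fun M : 'M_m => M a j)).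
rewrite !mxE (bigD1 a) //= big1 => [|l nla]; last first.
  by rewrite !mxE (negPf Ha) /= eq_sym (negPf nla) mul0r.
rewrite addr0 mxE (negPf Ha) eqxx mul1r => ->.
by case: eqP => // eaj; rewrite eaj win_self in Ha.
Qed.

Lemma upper_factor_out Y (j b : 'I_m) :
  ~~ window p j b -> upper_factor Y j b = 0.
Proof.
move=> Hb; have := @lower_factor_out Y^T b j Hb.
by rewrite lower_factor_tr mxE.
Qed.

(** The product of a block with its adjugate only reads entries of the band,
because two indices of one window are near each other. *)
Lemma near_lower_factor B Y (i j : 'I_m) :
    (forall a b, near p a b -> B a b = Y a b) -> window p j i ->
  \sum_l B i l * lower_factor Y l j = \det (window_block Y j) *+ (i == j).
Proof.
move=> BY wi.
have Lout l : ~~ window p j l -> \adj (window_block Y j) l j = 0.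
  by move/(lower_factor_out Y); rewrite mxE.
under eq_bigr => l _ do rewrite [lower_factor _ _ _]mxE.
have := mul_mx_adj (window_block Y j); move: (\adj _) (\det _) Lout => D d Lout.
move/(congr1 (fun M : 'M_m => M i j)); rewrite [in RHS]mxE => <-.
rewrite mxE; apply: eq_bigr => l _.
have [wl|wl] := boolP (window p j l); last by rewrite Lout // !mulr0.
by rewrite [window_block _ _ _ _]mxE wi wl (BY _ _ (near_window wi wl)).
Qed.

Lemma pivot_copivots Y j : copivots Y 0 j * pivot Y j = pivots Y.
Proof. by rewrite mxE mulrC [RHS](bigD1 j). Qed.

Lemma completion_far Y (a b : 'I_m) : ~~ near p a b -> completion Y a b = 0.
Proof.
move=> Hab; rewrite mxE big1 // => j _; rewrite mul_mx_diag mxE.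
have [wa|wa] := boolP (window p j a); last first.
  by rewrite (lower_factor_out Y wa) !mul0r.
have [wb|wb] := boolP (window p j b); last first.
  by rewrite (upper_factor_out Y wb) mulr0.
by rewrite (near_window wa wb) in Hab.
Qed.

(** The inverse of an upper triangular matrix is upper triangular, with the
inverse diagonal, up to the scalar c; the induction goes through the columns from the left. *)
Lemma mul_upper_scalar T U (c : R) :
    (forall i j : 'I_m, (j < i)%N -> U i j = 0) -> (forall i, U i i != 0) ->
    T *m U = c%:M ->
  forall i j : 'I_m, (j <= i)%N -> T i j * U j j = c *+ (i == j).
Proof.
move=> Ulow Udiag TU.
have step k : forall i j : 'I_m, (j < k)%N -> (j <= i)%N ->
    T i j * U j j = c *+ (i == j).
  elim: k => // k IH i j jk ji.
  have := congr1 (fun M : 'M_m => M i j) TU; rewrite [in RHS]mxE => <-.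
  rewrite mxE (bigD1 j) //= big1 ?addr0 // => l nlj.
  have [ljl|] := ltnP j l; first by rewrite Ulow // mulr0.
  rewrite leq_eqVlt => /orP [/eqP /val_inj e|lj]; first by rewrite e eqxx in nlj.
  have := IH i l (leq_trans lj jk) (ltnW (leq_trans lj ji)).
  have -> : (i == l) = false by apply/eqP => e; move: lj ji; rewrite e; lia.
  move/eqP; rewrite mulr0n mulf_eq0 (negPf (Udiag l)) orbF => /eqP ->.
  by rewrite mul0r.
by move=> i j; apply: (step m).
Qed.

Lemma upper_factor_low Y (i j : 'I_m) : (j < i)%N -> upper_factor Y i j = 0.
Proof. by move=> ji; rewrite upper_factor_out // /window; lia. Qed.

Lemma lower_factor_up Y (i j : 'I_m) : (i < j)%N -> lower_factor Y i j = 0.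
Proof. by move=> ij; rewrite lower_factor_out // /window; lia. Qed.

Section Pivots.
Variable Y : 'M[R]_m.
Hypothesis pivY : forall j, pivot Y j != 0.

Lemma lower_factor_diag_neq0 j : lower_factor Y j j != 0.
Proof. by apply: contraNneq (pivY j); rewrite mxE /pivot => ->; rewrite mulr0. Qed.

Lemma upper_factor_diag_neq0 j : upper_factor Y j j != 0.
Proof. by apply: contraNneq (pivY j); rewrite mxE /pivot => ->; rewrite mulr0. Qed.

Lemma pivots_neq0 : pivots Y != 0.
Proof. by apply/prodf_neq0 => j _. Qed.

Lemma copivots_neq0 j : copivots Y 0 j != 0.
Proof. by rewrite mxE; apply/prodf_neq0 => i _. Qed.

Lemma det_lower_factor_neq0 : \det (lower_factor Y) != 0.
Proof.
rewrite det_trig; first by apply/prodf_neq0 => j _; apply: lower_factor_diag_neq0.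
by apply/is_trig_mxP => i j; apply: lower_factor_up.
Qed.

Lemma det_completion_neq0 : \det (completion Y) != 0.
Proof.
have detU : \det (upper_factor Y) != 0.
  rewrite -det_tr det_trig.
    by apply/prodf_neq0 => j _; rewrite mxE upper_factor_diag_neq0.
  by apply/is_trig_mxP => i j ij; rewrite mxE upper_factor_low.
rewrite !det_mulmx det_diag !mulf_neq0 // ?det_lower_factor_neq0 //.
by apply/prodf_neq0 => j _; apply: copivots_neq0.
Qed.

End Pivots.

(** On the window at j, the columns at j of B L and of Y L are proportional to the
same unit vector: for Y by construction of L, for B because B L is,
up to scaling, the inverse of an upper triangular matrix. *)
Lemma inverse_lower_factor Y B c (i j : 'I_m) :
    (forall j, pivot Y j != 0) -> B *m completion Y = c%:M ->
    window p j i ->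
  \sum_l (pivots Y * B i l) * lower_factor Y l j =
    \sum_l (c * Y i l) * lower_factor Y l j.
Proof.
move=> pivY; rewrite /completion !mulmxA => BM wi.
have ji : (j <= i)%N by case/andP: wi.
have := mul_upper_scalar (@upper_factor_low Y) (upper_factor_diag_neq0 pivY) BM ji.
rewrite mul_mx_diag mxE => key.
under eq_bigr => l _ do rewrite -mulrA.
under [RHS]eq_bigr => l _ do rewrite -mulrA.
rewrite -!mulr_sumr (near_lower_factor (B := Y)) //.
rewrite -(pivot_copivots Y j) /pivot.
move: key; rewrite mxE [upper_factor Y j j]mxE => key.
rewrite mulrnAr mulrC -mulrnAl -key; ring.
Qed.

(** Descending induction on the smaller index j.  In the equations at j only the
entries with smaller index at least j occur; those with larger index vanish by
induction, so the equation at (i, j) reads E i j * L j j = 0 for i > j, and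
then the one at (j, j) gives the diagonal entry. *)
Lemma window_system_unique Y E :
    (forall j, pivot Y j != 0) ->
    (forall i j : 'I_m, window p j i -> \sum_l E i l * lower_factor Y l j = 0) ->
    (forall i j : 'I_m, window p j i -> \sum_l upper_factor Y j l * E l i = 0) ->
  forall i j : 'I_m, near p i j -> E i j = 0.
Proof.
move=> pivY EL UE.
have Ljj := lower_factor_diag_neq0 pivY.
have Ujj := upper_factor_diag_neq0 pivY.
suff claim k : forall i j : 'I_m, (m - j <= k)%N -> window p j i ->
    E i j = 0 /\ E j i = 0.
  move=> i j nij; have [ij|ji] := leqP i j.
    by case: (claim m j i) => //; move: nij; rewrite /near /window; lia.
  by case: (claim m i j) => //; move: nij; rewrite /near /window; lia.
elim: k => [|k IH] i j jk wi; first by have := ltn_ord j; lia.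
have off (a b : 'I_m) : window p j a -> window p j b -> (j < a)%N -> (j < b)%N ->
    E a b = 0.
  move=> wa wb ja jb; have [ab|ba] := leqP a b.
    by case: (IH b a) => //; move: wa wb; rewrite /window; lia.
  by case: (IH a b) => //; move: wa wb; rewrite /window; lia.
have lt_win l : window p j l -> l != j -> (j < l)%N.
  by case/andP => jl _ nlj; rewrite ltn_neqAle jl andbT eq_sym.
have one a : window p j a -> j != a -> E a j = 0 /\ E j a = 0.
  move=> wa nja; have ja : (j < a)%N by apply: lt_win; rewrite 1?eq_sym.
  split.
    have := EL a j wa; rewrite (bigD1 j) //= big1 => [|l nlj].
      by rewrite addr0 => /eqP; rewrite mulf_eq0 (negPf (Ljj j)) orbF => /eqP.
    have [wl|wl] := boolP (window p j l); last by rewrite lower_factor_out // mulr0.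
    by rewrite (off a l) ?mul0r // lt_win.
  have := UE a j wa; rewrite (bigD1 j) //= big1 => [|l nlj].
    by rewrite addr0 => /eqP; rewrite mulf_eq0 (negPf (Ujj j)) => /eqP.
  have [wl|wl] := boolP (window p j l); last by rewrite upper_factor_out // mul0r.
  by rewrite (off l a) ?mulr0 // lt_win.
have [<-|nji] := eqVneq j i; last exact: one.
suff: E j j = 0 by [].
have := EL j j (win_self j); rewrite (bigD1 j) //= big1 => [|l nlj].
  by rewrite addr0 => /eqP; rewrite mulf_eq0 (negPf (Ljj j)) orbF => /eqP.
have [wl|wl] := boolP (window p j l); last by rewrite lower_factor_out // mulr0.
by rewrite (one l wl _).2 ?mul0r // eq_sym.
Qed.

(** The band of a matrix is recovered from its completion: the difference of the
two sides satisfies the homogeneous window equations. *)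
Lemma inverse_completion_near Y B c :
    (forall j, pivot Y j != 0) ->
    B *m completion Y = c%:M -> completion Y *m B = c%:M ->
  forall i j : 'I_m, near p i j -> pivots Y * B i j = c * Y i j.
Proof.
move=> pivY BM MB i j nij; apply/eqP; rewrite -subr_eq0; apply/eqP.
pose E := \matrix_(i, j) (pivots Y * B i j - c * Y i j).
suff: E i j = 0 by rewrite mxE.
apply: (window_system_unique pivY) => // {nij}i {}j wi.
  under eq_bigr => l _ do rewrite [E _ _]mxE mulrBl.
  by rewrite sumrB (inverse_lower_factor pivY BM wi) subrr.
have pivYT k : pivot Y^T k != 0 by rewrite pivot_tr.
have MBT : B^T *m completion Y^T = c%:M.
  by rewrite completion_tr -trmx_mul MB tr_scalar_mx.
have := inverse_lower_factor pivYT MBT wi; rewrite lower_factor_tr pivots_tr => key.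
under eq_bigr => l _ do rewrite [E _ _]mxE mulrBr.
rewrite sumrB; apply/eqP; rewrite subr_eq0; apply/eqP.
transitivity (\sum_l pivots Y * B^T i l * (upper_factor Y)^T l j).
  by apply: eq_bigr => l _; rewrite [B^T _ _]mxE [_^T _ _]mxE mulrC.
by rewrite key; apply: eq_bigr => l _; rewrite [Y^T _ _]mxE [_^T _ _]mxE mulrC.
Qed.

(** A column v of B L is known on its window.  Below the window, A v = c L vanishes,
and as A is a band matrix and v vanishes on the window past j, these equations
only involve the entries of v below the window; they form a square system with
the trailing block of A as matrix. *)
Lemma inverse_mul_lower A B Y c :
    (forall a b : 'I_m, ~~ near p a b -> A a b = 0) ->
    (forall k, \det (padded_block (fun i : 'I_m => (k < i)%N) A) != 0) ->
    A *m B = c%:M ->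
    (forall a b, near p a b -> B a b = Y a b) ->
  forall i j : 'I_m, (j <= i)%N ->
    (B *m lower_factor Y) i j = \det (window_block Y j) *+ (i == j).
Proof.
move=> Afar detA AB BY i j ji; set V := B *m _.
have Vwin l : window p j l -> V l j = \det (window_block Y j) *+ (l == j).
  by move=> wl; rewrite mxE near_lower_factor.
have AV (l : 'I_m) : ~~ window p j l -> \sum_a A l a * V a j = 0.
  move=> wl; transitivity ((A *m V) l j); first by rewrite mxE.
  by rewrite /V mulmxA AB mul_scalar_mx mxE lower_factor_out // mulr0.
clearbody V.
have [ijp|jpi] := leqP i (j + p); first by rewrite Vwin // /window ji.
(* The part of column j below its window. *)
pose u : 'cV[R]_m := \col_l (V l j *+ (j + p < l)%N).
set P := padded_block (fun i : 'I_m => (j + p < i)%N) A.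
suff u0 : u = 0.
  have := congr1 (fun M : 'cV_m => M i 0) u0.
  rewrite [LHS]mxE [RHS]mxE jpi /= mulr1n => ->.
  by have -> : (i == j) = false by apply/eqP => e; move: jpi; rewrite e; lia.
have Pu : P *m u = 0.
  apply/colP => l; rewrite !mxE; have [lw|lw] := ltnP (j + p) l; last first.
    rewrite big1 // => a _; rewrite !mxE [(j + p < l)%N]ltnNge lw /=.
    by have [<-|] := eqVneq l a; rewrite ?mul0r // ltnNge lw mulr0.
  rewrite -[RHS](AV l); last by rewrite /window; lia.
  apply: eq_bigr => a _; rewrite !mxE lw /=.
  have [aw|aw] := ltnP (j + p) a; first by [].
  rewrite mulr0; have [aj|ja] := leqP a j.
    by rewrite Afar ?mul0r // /near; lia.
  rewrite Vwin; last by rewrite /window; lia.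
  have -> : (a == j) = false by apply/eqP => e; move: ja; rewrite e; lia.
  by rewrite mulr0.
have := mulmxA (\adj P) P u; rewrite Pu mulmx0 mul_adj_mx mul_scalar_mx => e.
apply/colP => l; have := congr1 (fun M : 'cV_m => M l 0) e; rewrite [LHS]mxE [RHS]mxE.
by move/esym/eqP; rewrite mulf_eq0 (negPf (detA _)) => /eqP ->; rewrite mxE.
Qed.

(** B L is upper and U B lower triangular, so that U B L is both, that is,
diagonal, with the pivots on the diagonal.  Solving for the inverse of B gives the
matrix L D U, which is the completion. *)
Lemma completion_inverse A B Y c :
    (forall a b : 'I_m, ~~ near p a b -> A a b = 0) ->
    (forall k, \det (padded_block (fun i : 'I_m => (k < i)%N) A) != 0) ->
    A *m B = c%:M -> B *m A = c%:M ->
    (forall a b, near p a b -> B a b = Y a b) ->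
    (forall j, pivot Y j != 0) ->
  c *: completion Y = pivots Y *: A.
Proof.
move=> Afar detA AB BA BY pivY.
set L := lower_factor Y; set U := upper_factor Y.
have BL := inverse_mul_lower Afar detA AB BY.
have UB (i j : 'I_m) : (i <= j)%N -> (U *m B) i j = \det (window_block Y i) *+ (i == j).
  move=> ij.
  (* The rows of U are handled by transposing everything. *)
  have AfarT (a b : 'I_m) : ~~ near p a b -> A^T a b = 0.
    by rewrite mxE nearC; apply: Afar.
  have detAT k : \det (padded_block (fun i : 'I_m => (k < i)%N) A^T) != 0.
    by rewrite tr_padded_block det_tr.
  have ABT : A^T *m B^T = c%:M by rewrite -trmx_mul BA tr_scalar_mx.
  have BYT a b : near p a b -> B^T a b = Y^T a b by rewrite nearC !mxE; apply: BY.
  have := inverse_mul_lower AfarT detAT ABT BYT ij.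
  by rewrite lower_factor_tr -trmx_mul mxE /window_block tr_padded_block det_tr eq_sym.
have UBL : U *m B *m L = diag_mx (\row_j pivot Y j).
  apply/matrixP => i j; rewrite [RHS]mxE; have [ji|ij] := ltnP j i.
    have -> : (i == j) = false by apply/eqP => e; move: ji; rewrite e ltnn.
    rewrite -mulmxA mxE big1 // => l _; have [il|li] := leqP i l.
      rewrite BL ?(leq_trans (ltnW ji)) //.
      have -> : (l == j) = false by apply/eqP => e; move: il; rewrite e leqNgt ji.
      by rewrite mulr0.
    by rewrite /U upper_factor_low // mul0r.
  rewrite mxE (bigD1 i) //= big1 => [|l nli]; last first.
    have [il|li] := leqP i l.
      by rewrite UB // eq_sym (negPf nli) mul0r.
    by rewrite /L lower_factor_up ?mulr0 // (leq_trans li).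
  rewrite addr0 UB // eqxx mxE; have [<-|nij] := eqVneq i j.
    by rewrite /L [lower_factor _ _ _]mxE.
  rewrite /L lower_factor_up ?mulr0 // ltn_neqAle ij andbT.
  by apply: contraNneq nij => /val_inj ->.
have MBL : completion Y *m B *m L = pivots Y *: L.
  have -> : completion Y *m B *m L = L *m diag_mx (copivots Y) *m (U *m B *m L).
    by rewrite /completion !mulmxA.
  rewrite UBL; apply/matrixP => i j; rewrite mul_mx_diag mxE mul_mx_diag mxE.
  have -> : (\row_j pivot Y j) 0 j = pivot Y j by rewrite mxE.
  by rewrite [RHS]mxE -(pivot_copivots Y j) mxE -mulrA mulrC.
have MB : completion Y *m B = (pivots Y)%:M.
  have : (completion Y *m B - (pivots Y)%:M) *m L *m \adj L = 0.
    by rewrite mulmxBl MBL mul_scalar_mx subrr mul0mx.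
  rewrite -mulmxA mul_mx_adj mul_mx_scalar => /eqP.
  rewrite scalemx_eq0 (negPf (det_lower_factor_neq0 pivY)) subr_eq0 /=.
  by move/eqP.
by rewrite -[RHS]mul_scalar_mx -MB -mulmxA BA mul_mx_scalar.
Qed.
End Solve.
End Completion.

(** * Specialization to scalar matrices *)

Section Scalar.
Variables (R : idomainType) (m : nat).

Lemma padded_block_scalar (S : pred 'I_m) (c : R) :
  padded_block S c%:M = diag_mx (\row_a if S a then c else 1).
Proof.
apply/matrixP => a b; rewrite !mxE.
by have [<-|nab] := eqVneq a b; [rewrite andbb !mulr1n | rewrite !mulr0n if_same].
Qed.

Lemma det_padded_scalar_neq0 (S : pred 'I_m) (c : R) :
  c != 0 -> \det (padded_block S c%:M) != 0.
Proof.
move=> c0; rewrite padded_block_scalar det_diag; apply/prodf_neq0 => a _.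
by rewrite mxE; case: ifP => // _; apply: oner_neq0.
Qed.

(** The specialization at which the pivots of the generic matrix are seen not to
vanish.  The scalar is kept general because the adjugate of G, with reversed
rows, becomes a scalar matrix equal to 1 or -1. *)
Lemma pivot_scalar_neq0 p (c : R) (j : 'I_m) :
  c != 0 -> pivot p (c%:M : 'M[R]_m) j != 0.
Proof.
move=> c0; rewrite /pivot /window_block.
have := det_padded_scalar_neq0 (window p j) c0.
have := mul_mx_adj (padded_block (window p j) (c%:M : 'M[R]_m)).
move: (\adj _) (\det _) => D d e d0; rewrite mulf_neq0 //.
move: e; rewrite padded_block_scalar => /(congr1 (fun M : 'M_m => M j j)).
rewrite mul_diag_mx !mxE eqxx mulr1n => e.
by apply: contraNneq d0 => D0; rewrite -e D0 mulr0.
Qed.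

End Scalar.

(** * Degrees *)

Section Homogeneous.
Variables (k : fieldType) (n : nat).
Implicit Types (f : {mpoly k[n]}).

Lemma dhomog_bigprod (I : Type) (r : seq I) (P : pred I)
    (F : I -> {mpoly k[n]}) (d : I -> nat) :
    (forall i, P i -> F i \is (d i).-homog) ->
  \prod_(i <- r | P i) F i \is (\sum_(i <- r | P i) d i)%N.-homog.
Proof.
move=> H; apply: (big_rec2 (fun f e => f \is e.-homog)); first exact: dhomog1.
by move=> i e f Pi He; apply: dhomogM => //; apply: H.
Qed.

(** The degree is allowed to depend on the row: the rows of padded blocks outside
the window have degree 0. *)
Lemma dhomog_det q (A : 'M[{mpoly k[n]}]_q) (d : 'I_q -> nat) :
    (forall i j, A i j \is (d i).-homog) ->
  \det A \is (\sum_i d i)%N.-homog.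
Proof.
move=> H; apply: rpred_sum => s _; rewrite mulr_sign.
suff: \prod_i A i (s i) \is (\sum_i d i)%N.-homog.
  by case: ifP; rewrite ?dhomogN.
exact: dhomog_bigprod.
Qed.

Lemma dhomog_cofactor q (A : 'M[{mpoly k[n]}]_q) (d : 'I_q -> nat) i j :
    (forall i j, A i j \is (d i).-homog) ->
  cofactor A i j \is (\sum_u d (lift i u))%N.-homog.
Proof.
move=> H; rewrite /cofactor -signr_odd mulr_sign.
suff: \det (row' i (col' j A)) \is (\sum_u d (lift i u))%N.-homog.
  by case: odd; rewrite ?dhomogN.
by apply: dhomog_det => u v; rewrite !mxE.
Qed.

Section CompletionDegree.
Variables (m p : nat) (Y : 'M[{mpoly k[n]}]_m).
Hypothesis homY : forall a b, Y a b \is 1.-homog.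

Let cdeg (j : 'I_m) : nat := \sum_u window p j (lift j u).

Lemma dhomog_window_block j a b :
  window_block p Y j a b \is (window p j a : nat).-homog.
Proof.
rewrite mxE; case wa: (window p j a) => /=.
  case wb: (window p j b) => //; case: eqP => [e|_]; last exact: dhomog0.
  by rewrite -e wa in wb.
by case: eqP => _; rewrite ?dhomog1 ?dhomog0.
Qed.

Lemma dhomog_lower_factor a j : lower_factor p Y a j \is (cdeg j).-homog.
Proof.
rewrite 2!mxE; exact: (dhomog_cofactor j a (dhomog_window_block j)).
Qed.

Lemma dhomog_det_window_block j : \det (window_block p Y j) \is (cdeg j).+1.-homog.
Proof.
have := dhomog_det (dhomog_window_block j).
by rewrite (bigD1_ord j) //= win_self.
Qed.

End CompletionDegree.

Lemma dhomog_upper_factor m p (Y : 'M[{mpoly k[n]}]_m) j b :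
    (forall a b, Y a b \is 1.-homog) ->
  upper_factor p Y j b \is (\sum_u window p j (lift j u))%N.-homog.
Proof.
move=> H; have HT a c : Y^T a c \is 1.-homog by rewrite mxE.
by have := dhomog_lower_factor p HT b j; rewrite lower_factor_tr mxE.
Qed.

(** In the term at j, the j-th pivot, of degree 2 c + 1, is replaced by the product
of two entries of degree c; so all terms have the same degree. *)
Lemma dhomog_completion m p (Y : 'M[{mpoly k[n]}]_m) :
    (forall a b, Y a b \is 1.-homog) ->
  exists d, forall a b, completion p Y a b \is d.-homog.
Proof.
move=> H; pose c (j : 'I_m) := (\sum_u window p j (lift j u))%N.
(* The degree of the product of all pivots, less 1. *)
exists (\sum_j ((c j).+1 + c j)).-1%N => a b.
rewrite mxE; apply: rpred_sum => j _; rewrite mul_mx_diag mxE.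
have -> : ((\sum_j ((c j).+1 + c j)).-1 =
   c j + (\sum_(i | i != j) ((c i).+1 + c i)) + c j)%N.
  by rewrite (bigD1 j) //=; lia.
apply: dhomogM; last exact: dhomog_upper_factor.
apply: dhomogM; first exact: dhomog_lower_factor.
rewrite mxE; apply: dhomog_bigprod => i _; apply: dhomogM.
  exact: dhomog_det_window_block.
by have := dhomog_lower_factor p H i i; rewrite mxE.
Qed.

End Homogeneous.

(** * Reversal of the columns *)

Section Reversal.
Variables (R : comPzRingType) (m : nat).
Implicit Type A : 'M[R]_m.

Definition rev_cols A : 'M[R]_m := \matrix_(i, j) A i (rev_ord j).
Definition rev_rows A : 'M[R]_m := \matrix_(i, j) A (rev_ord i) j.

Lemma det_rev_cols A : \det (rev_cols A) = (-1) ^+ perm (@rev_ord_inj m) * \det A.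
Proof.
have -> : rev_cols A = col_perm (perm (@rev_ord_inj m)) A.
  by apply/matrixP => i j; rewrite !mxE permE.
by rewrite col_permE det_mulmx det_perm odd_permV mulrC.
Qed.

Lemma mul_rev_adj_rev A : rev_rows (\adj A) *m rev_cols A = (\det A)%:M.
Proof.
apply/matrixP => i j.
transitivity ((\adj A *m A) (rev_ord i) (rev_ord j)).
  rewrite [LHS]mxE [RHS]mxE; apply: eq_bigr => l _.
  by rewrite [rev_rows _ _ _]mxE [rev_cols _ _ _]mxE.
by rewrite mul_adj_mx mxE [RHS]mxE (inj_eq rev_ord_inj).
Qed.

Lemma mul_rev_rev_adj A : rev_cols A *m rev_rows (\adj A) = (\det A)%:M.
Proof.
rewrite -mul_mx_adj; apply/matrixP => i j.
rewrite [LHS]mxE [RHS]mxE (reindex_inj rev_ord_inj).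
apply: eq_bigr => l _; rewrite [rev_rows _ _ _]mxE [rev_cols _ _ _]mxE.
by rewrite rev_ordK.
Qed.

End Reversal.

(** * Partial derivatives of the determinant *)

Section Derivatives.
Variable k : fieldType.

Lemma mderivXU (N : nat) (t u : 'I_N) :
  ('X_u : {mpoly k[N]})^`M(t) = (u == t)%:R.
Proof.
rewrite mderivX mnm1E; have [->|_] := eqVneq; last by rewrite scale0r.
have -> : (U_(t) - U_(t))%MM = 0%MM by apply/mnmP => i; rewrite !mnmE subnn.
by rewrite mpolyX0 scale1r.
Qed.

Lemma mpolyXU_neq0 (N : nat) (u : 'I_N) : ('X_u : {mpoly k[N]}) != 0.
Proof.
apply/eqP => /(congr1 (mderiv u)).
by rewrite mderivXU eqxx mderiv0 => /eqP; rewrite oner_eq0.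
Qed.

Lemma mderiv_det0 (N q : nat) (t : 'I_N) (A : 'M[{mpoly k[N]}]_q) :
  (forall i j, (A i j)^`M(t) = 0) -> (\det A)^`M(t) = 0.
Proof.
move=> H; rewrite raddf_sum big1 // => s0 _; rewrite mulr_sign.
have P0 : (\prod_i A i (s0 i))^`M(t) = 0.
  apply: (big_ind (fun f => f^`M(t) = 0)) => //; first by rewrite -mpolyC1 mderivC.
  by move=> f g f0 g0; rewrite mderivM f0 g0 mul0r mulr0 addr0.
by rewrite /=; case: ifP => _; rewrite ?mderivN ?P0 ?oppr0. 
Qed.


End Derivatives.

Section Generic.
Variables (k : fieldType) (m r s : nat).
Local Notation n := (nvars m r s).
Local Notation G := (Gmx k m r s).

(** The position of the entry of the matrix which is the t-th variable. *)
Definition pos (t : 'I_n) : 'I_m * 'I_m := val (enum_val t : band_pos m r s).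

Lemma pos_in_band t : in_band r s (pos t).
Proof. exact: valP (enum_val t). Qed.

Lemma pos_onto q : in_band r s q -> exists t, pos t = q.
Proof.
move=> Hq; exists (enum_rank (Sub q Hq : band_pos m r s)).
by rewrite /pos enum_rankK.
Qed.

Lemma pos_inj : injective pos.
Proof. by move=> t u /val_inj /enum_val_inj. Qed.

Lemma Gmx_pos t : G (pos t).1 (pos t).2 = 'X_t.
Proof. by rewrite mxE -surjective_pairing valK enum_valK. Qed.

Lemma Gmx_out i j : ~~ in_band r s (i, j) -> G i j = 0.
Proof. by move=> H; rewrite mxE insubN. Qed.

Lemma map_Gmx (S : comPzRingType) (g : {rmorphism {mpoly k[n]} -> S})
    (H : 'I_m -> 'I_m -> S) :
    (forall t, g 'X_t = H (pos t).1 (pos t).2) ->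
  map_mx g G = \matrix_(i, j) if in_band r s (i, j) then H i j else 0.
Proof.
move=> gH; apply/matrixP => i j; rewrite [LHS]mxE [RHS]mxE.
case: ifPn => [/pos_onto [t et]|]; last by move/Gmx_out ->; rewrite rmorph0.
by have := gH t; rewrite -Gmx_pos et.
Qed.

Lemma Gmx_homog i j : G i j \is 1.-homog.
Proof.
have [/pos_onto [t et]|/Gmx_out ->] := boolP (in_band r s (i, j)); last exact: dhomog0.
by have := Gmx_pos t; rewrite et /= => ->; rewrite dhomogX /= mdeg1.
Qed.

Lemma mderiv_Gmx t i j : (G i j)^`M(t) = ((i, j) == pos t)%:R.
Proof.
have [/pos_onto [u eu]|H] := boolP (in_band r s (i, j)).
  have -> : G i j = 'X_u by rewrite -Gmx_pos eu.
  by rewrite -eu mderivXU (inj_eq pos_inj).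
rewrite Gmx_out // mderiv0; case: eqP => // e.
by move: H; rewrite e pos_in_band.
Qed.

(** The cofactor is a minor that avoids the row of the t-th variable. *)
Lemma mderiv_cofactor_row t j : (cofactor G (pos t).1 j)^`M(t) = 0.
Proof.
rewrite /cofactor -signr_odd mulr_sign.
have D0 : (\det (row' (pos t).1 (col' j G)))^`M(t) = 0.
  apply: mderiv_det0 => u v; rewrite [row' _ _ _ _]mxE [col' _ _ _ _]mxE mderiv_Gmx.
  case: eqP => // /(congr1 fst) /= e; have := neq_lift (pos t).1 u.
  by rewrite e eqxx.
by case: odd; rewrite ?mderivN D0 ?oppr0.
Qed.

Lemma mderiv_fdet t :
  (fdet k m r s)^`M(t) = cofactor G (pos t).1 (pos t).2.
Proof.
rewrite /fdet (expand_det_row _ (pos t).1) raddf_sum /=.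
have D j : (G (pos t).1 j * cofactor G (pos t).1 j)^`M(t) =
    ((pos t).2 == j)%:R * cofactor G (pos t).1 j.
  have := mderiv_cofactor_row t j; move: (cofactor _ _ _) => C C0.
  rewrite mderivM C0 mulr0 addr0 mderiv_Gmx [pos t in RHS]surjective_pairing.
  by rewrite {2}[pos t]surjective_pairing xpair_eqE eqxx eq_sym.
under eq_bigr => j _ do rewrite D.
rewrite (bigD1 (pos t).2) //= eqxx mul1r big1 ?addr0 // => j nj.
by rewrite eq_sym (negPf nj) mul0r.
Qed.

Lemma fdet_homog : is_form (fdet k m r s).
Proof. by eexists; apply: (dhomog_det (d := fun=> 1%N)) => i j; apply: Gmx_homog. Qed.

Lemma sum_pos (V : nmodType) (F : 'I_m * 'I_m -> V) :
  (forall q, ~~ in_band r s q -> F q = 0) -> \sum_t F (pos t) = \sum_q F q.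
Proof.
move=> F0; rewrite [RHS](bigID (in_band r s)) /= [X in _ + X]big1 // addr0.
rewrite (big_sub (in_band r s)) (reindex (@enum_rank (band_pos m r s))) /=.
  by apply: eq_bigr => e _; rewrite /pos enum_rankK.
exact/onW_bij/enum_rank_bij.
Qed.

End Generic.

(** * The Hessian for r < s *)

Section Hessian.
Variables (k : fieldType) (m r s : nat).
Hypotheses (rs : (r < s)%N) (hm : (3 <= m)%N) (hs : (s <= m - 2)%N).
Local Notation n := (nvars m r s).
Local Notation G := (Gmx k m r s).

Let q := (m - s)%N.

Let rowq_lt (u : 'I_q) : (u < m)%N. Proof. by have := ltn_ord u; rewrite /q; lia. Qed.
Let colq_lt (v : 'I_q) : (r + v < m)%N. Proof. by have := ltn_ord v; rewrite /q; lia. Qed.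
Let rowq u := Ordinal (rowq_lt u).
Let colq v := Ordinal (colq_lt v).
Let last_lt : (m.-1 < m)%N. Proof. by lia. Qed.
Let last := Ordinal last_lt.

Lemma last_col_out (i : 'I_m) : (q <= i)%N -> G i last = 0.
Proof. by move=> qi; rewrite Gmx_out // /in_band /=; move: qi; rewrite /q; lia. Qed.

Lemma last_col_cofactor (b : 'I_m) : b != last -> \sum_i G i last * cofactor G i b = 0.
Proof.
move=> nb; transitivity ((\adj G *m G) b last).
  by rewrite mxE; apply: eq_bigr => i _; rewrite [\adj _ _ _]mxE mulrC.
by rewrite mul_adj_mx mxE (negPf nb).
Qed.

(** The last column z of G is supported on the rows i < q = m - s and is
orthogonal to the cofactor columns other than the last one, so z kills the
q x q block of cofactors in the rows i < q and the columns r <= b < r + q from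
the left.  The block is singular, and w is a vector that it kills from the
right, extended by 0. *)
Lemma corner_minor_kernel : exists w : 'I_m -> {mpoly k[n]},
  [/\ exists b, w b != 0,
      forall b : 'I_m, w b != 0 -> (r <= b < r + q)%N &
      forall i : 'I_m, (i < q)%N -> \sum_b w b * cofactor G i b = 0].
Proof.
pose N : 'M[{mpoly k[n]}]_q := \matrix_(u, v) cofactor G (rowq u) (colq v).
have q0 : (0 < q)%N by rewrite /q; lia.
have m0 : (0 < m)%N by lia.
have : \det N == 0.
  apply/det0P; exists (\row_u G (rowq u) last).
    apply/rV0Pn; exists (Ordinal q0); rewrite mxE.
    have [|t et] := @pos_onto m r s (Ordinal m0, last).
      by rewrite /in_band /=; lia.
    have := Gmx_pos k t; rewrite et /= => e.
    have -> : rowq (Ordinal q0) = Ordinal m0 by apply: val_inj.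
    by rewrite e mpolyXU_neq0.
  apply/rowP => v; rewrite !mxE.
  under eq_bigr => u _ do rewrite [N _ _]mxE mxE.
  (* This is where r < s enters: the columns of the block stop before the last. *)
  have nv : colq v != last.
    by apply/eqP => /(congr1 val) /=; have := ltn_ord v; rewrite /q; lia.
  rewrite -[RHS](last_col_cofactor nv) [RHS](bigID (fun i : 'I_m => (i < q)%N)) /=.
  rewrite [X in _ = _ + X]big1 ?addr0; last first.
    by move=> i; rewrite -leqNgt => /last_col_out ->; rewrite mul0r.
  rewrite (big_ord_narrow (F := fun i => G i last * cofactor G i (colq v))) ?leq_subr //.
  move=> qm; apply: eq_bigr => u _.
  by congr (G _ _ * cofactor G _ _); apply: val_inj.
rewrite -det_tr => /det0P [w /rV0Pn [v0 wv0] wN].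
pose W (b : 'I_m) := if insub (b - r)%N is Some v then w 0 v *+ (r <= b)%N else 0.
have Wcol v : W (colq v) = w 0 v.
  rewrite /W /= addKn leq_addr.
  by case: insubP => [u _ /val_inj -> //|]; rewrite ltn_ord.
have Wsupp (b : 'I_m) : W b != 0 -> (r <= b < r + q)%N.
  rewrite /W; case: insubP => [u _ eu|]; last by rewrite eqxx.
  have := ltn_ord u; rewrite eu; case: (leqP r b) => //=; last by rewrite mulr0n eqxx.
  by lia.
exists W; split=> // [|i iq]; first by exists (colq v0); rewrite Wcol.
have := congr1 (fun M : 'rV_q => M 0 (Ordinal iq)) wN.
rewrite [RHS]mxE mxE => wN0; rewrite -[RHS]wN0.
rewrite (bigID (fun b : 'I_m => (r <= b < r + q)%N)) /= [X in _ + X]big1 ?addr0.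
  rewrite (reindex_onto colq (fun b => insubd v0 (b - r)%N)) /=; last first.
    move=> b /andP [rb bq]; apply: val_inj; rewrite /= val_insubd.
    by rewrite ifT ?subnKC //; lia.
  apply: eq_big => v; last first.
    move=> _; rewrite Wcol [N^T _ _]mxE [N _ _]mxE.
    by congr (_ * cofactor G _ _); apply: val_inj.
  rewrite leq_addr ltn_add2l ltn_ord /=; apply/eqP; apply: val_inj.
  by rewrite val_insubd /= addKn ltn_ord.
move=> b; have [->|/Wsupp ->//] := eqVneq (W b) 0; by rewrite mul0r.
Qed.

(** Differentiate the relation between z and the cofactor column b, multiply by
w b and sum over b: the terms in which z is differentiated cancel, as w is
orthogonal to the rows i < q of cofactors and z vanishes in the other rows.  What
remains says that the vector z_i * w_b is in the kernel of the Hessian. *)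
Lemma vanishing_hessian_fdet : vanishing_hessian (fdet k m r s).
Proof.
split; first exact: fdet_homog.
have [w [[b0 wb0] wsupp wC]] := corner_minor_kernel.
have m0 : (0 < m)%N by lia.
(* Row 0 has a variable in the last column, hence z_0 * w_b is not 0. *)
apply/eqP/det0P; exists (\row_t (G (pos t).1 last * w (pos t).2)).
  have [|t et] := @pos_onto m r s (Ordinal m0, b0).
    by have := wsupp b0 wb0; rewrite /in_band /q /=; lia.
  apply/rV0Pn; exists t; rewrite mxE et mulf_neq0 //=.
  have [|u eu] := @pos_onto m r s (Ordinal m0, last).
    by rewrite /in_band /=; lia.
  by have := Gmx_pos k u; rewrite eu /= => ->; apply: mpolyXU_neq0.
apply/rowP => e; rewrite [RHS]mxE mxE.
under eq_bigr => t _ do rewrite [(\row__ _) _ _]mxE [hessian _ _ _]mxE mderiv_fdet.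
pose F (x : 'I_m * 'I_m) := G x.1 last * w x.2 * (cofactor G x.1 x.2)^`M(e).
rewrite (sum_pos (F := F)); last first.
  move=> [i b] Hib; rewrite /F /=.
  have [->|wb] := eqVneq (w b) 0; first by rewrite mulr0 mul0r.
  rewrite last_col_out ?mul0r //; have := wsupp _ wb; move: Hib.
  by rewrite /in_band /q /=; lia.
rewrite -(pair_bigA _ (fun i b => F (i, b))) exchange_big /= {}/F /=.
have step b : \sum_i G i last * w b * (cofactor G i b)^`M(e) =
    - \sum_i (G i last)^`M(e) * (w b * cofactor G i b).
  have [->|wb] := eqVneq (w b) 0.
    rewrite !big1 ?oppr0 // => i _; first by rewrite mul0r mulr0.
    by rewrite mulr0 mul0r.
  have nb : b != last.
    apply/eqP => e'; have := wsupp _ wb; rewrite e' /q /=; lia.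
  have := congr1 (mderiv e) (last_col_cofactor nb).
  rewrite mderiv0 raddf_sum /=; under eq_bigr => i _ do rewrite mderivM.
  rewrite big_split /= => /eqP; rewrite addr_eq0 => /eqP E.
  transitivity (w b * \sum_i G i last * (cofactor G i b)^`M(e)).
    by rewrite mulr_sumr; apply: eq_bigr => i _; ring.
  rewrite -[X in w b * X]opprK -E mulrN mulr_sumr; congr (- _).
  by apply: eq_bigr => i _; ring.
under eq_bigr => b _ do rewrite step.
rewrite sumrN exchange_big /= big1 ?oppr0 // => i _.
rewrite -mulr_sumr; have [iq|qi] := ltnP i q; first by rewrite wC // mulr0.
by rewrite last_col_out // mderiv0 mul0r.
Qed.

End Hessian.

(** * The inverse of the polar map for r = s *)

Lemma same_ratmap_scale (k : fieldType) (n p : nat)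
    (F H : p.-tuple {mpoly k[n]}) (c d : {mpoly k[n]}) :
    c != 0 -> d != 0 -> nonzero_tuple H ->
    (forall i, c * tnth F i = d * tnth H i) ->
  same_ratmap F H.
Proof.
move=> c0 d0 [i Hi] cF; split; [| by exists i |].
  exists i; apply: contraNneq (mulf_neq0 d0 Hi) => F0.
  by rewrite -cF F0 mulr0.
move=> {Hi}i j; apply: (mulfI c0); rewrite mulrA cF mulrA cF; ring.
Qed.

Lemma window_block_near (R : pzRingType) (m p : nat) (Y Z : 'M[R]_m) j :
  (forall a b, near p a b -> Y a b = Z a b) -> window_block p Y j = window_block p Z j.
Proof.
move=> YZ; apply/matrixP => a b; rewrite !mxE; case: ifP => // /andP [wa wb].
by rewrite YZ // (near_window wa wb).
Qed.

Section Polar.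
Variables (k : fieldType) (m r : nat).
Hypotheses (m0 : (0 < m)%N) (rm : (r < m)%N).
Local Notation n := (nvars m r r).
Local Notation G := (Gmx k m r r).
Local Notation P := {mpoly k[n]}.
Local Notation f := (fdet k m r r).

Let p := (m - r.+1)%N.
Let X : 'M[P]_m := rev_cols G.

Lemma in_band_near (a b : 'I_m) : in_band r r (b, rev_ord a) = near p a b.
Proof.
rewrite /in_band /near /p /=; have := ltn_ord a; have := ltn_ord b; lia.
Qed.

Lemma X_far a b : ~~ near p a b -> X a b = 0.
Proof. by rewrite nearC mxE => H; rewrite Gmx_out // in_band_near. Qed.

(** The derivative of f at (i, j) is the entry (rev j, i) of f times the inverse of X;
hence the transpose of X stands for the band of the inverse. *)
Definition inverse_polar : n.-tuple P :=
  [tuple completion p X^T (pos t).1 (rev_ord (pos t).2) | t < n].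

Lemma tnth_polar_map t : tnth (polar_map f) t = cofactor G (pos t).1 (pos t).2.
Proof. by rewrite tnth_mktuple mderiv_fdet. Qed.

Lemma comp_mpoly_var (F : n.-tuple P) t : 'X_t \mPo F = tnth F t.
Proof. by rewrite comp_mpolyXU (tnth_nth 0). Qed.

(** The point where X is the identity matrix; there all principal blocks of X and of
its inverse are invertible. *)
Definition identity_point (t : 'I_n) : k := ((pos t).2 == rev_ord (pos t).1)%:R.

Lemma meval_identity_X : map_mx (meval identity_point) X = 1%:M.
Proof.
have E := @map_Gmx k m r r k (meval identity_point) (fun i j => (j == rev_ord i)%:R).
have {}E := E (fun t => mevalXU _ _).
apply/matrixP => i j; rewrite [LHS]mxE [X _ _]mxE [RHS]mxE.
have := congr1 (fun M : 'M_m => M i (rev_ord j)) E; rewrite [LHS]mxE => ->.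
rewrite mxE (inj_eq rev_ord_inj) in_band_near eq_sym.
by case: eqP => [->|_]; rewrite ?if_same // /near leq_addr.
Qed.

Lemma meval_identity_f : (meval identity_point) f != 0.
Proof.
have : (meval identity_point) (\det X) = 1 by rewrite -det_map_mx meval_identity_X det1.
rewrite det_rev_cols rmorphM /= => e; apply/eqP => f0.
by move: e; rewrite /fdet in f0; rewrite f0 mulr0 => /esym/eqP; rewrite oner_eq0.
Qed.

Lemma meval_neq0 (g : P) : (meval identity_point) g != 0 -> g != 0.
Proof. by apply: contraNneq => ->; rewrite rmorph0. Qed.

Lemma fdet_neq0 : f != 0. Proof. exact: meval_neq0 meval_identity_f. Qed.

Lemma pivot_X_neq0 j : pivot p X^T j != 0.
Proof.
apply: meval_neq0; rewrite map_pivot -map_trmx meval_identity_X trmx1.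
by apply: pivot_scalar_neq0; apply: oner_neq0.
Qed.

(** Substituting the partial derivatives for the variables in the transpose of X
gives the band of f times the inverse of X, to which [completion_inverse] applies. *)
Lemma inverse_polar_after_polar : exists2 d : P, d != 0 &
  forall t, f * tnth (comp_ratmap inverse_polar (polar_map f)) t = d * 'X_t.
Proof.
pose F := polar_map f.
pose B : 'M[P]_m := rev_rows (\adj G).
pose Y := map_mx (comp_mpoly F) X^T.
have BY a b : near p a b -> B a b = Y a b.
  rewrite -in_band_near => /pos_onto [t et].
  rewrite [RHS]mxE [X^T _ _]mxE [X _ _]mxE [LHS]mxE [LHS]mxE.
  by have := Gmx_pos k t; rewrite et /= => ->; rewrite comp_mpoly_var tnth_polar_map et.
have BX : B *m X = f%:M by apply: mul_rev_adj_rev.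
have XB : X *m B = f%:M by apply: mul_rev_rev_adj.
have pivY j : pivot p Y j != 0.
  rewrite /pivot -(window_block_near j BY) -/(pivot p B j).
  apply: meval_neq0; rewrite map_pivot.
  have -> : map_mx (meval identity_point) B = ((meval identity_point) f)%:M.
    by rewrite -map_scalar_mx -BX map_mxM meval_identity_X mulmx1.
  exact: pivot_scalar_neq0 meval_identity_f.
have detX e : \det (padded_block (fun i : 'I_m => (e < i)%N) X) != 0.
  apply: meval_neq0; rewrite -det_map_mx map_padded_block meval_identity_X.
  by apply: det_padded_scalar_neq0; apply: oner_neq0.
have E := completion_inverse X_far detX XB BX BY pivY.
exists (pivots p Y); first exact: pivots_neq0.
move=> t; rewrite !tnth_mktuple -/F.
have := congr1 (fun M : 'M_m => M (pos t).1 (rev_ord (pos t).2)) E.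
rewrite [LHS]mxE [RHS]mxE -map_completion [map_mx _ _ _ _]mxE => ->.
by rewrite [X _ _]mxE rev_ordK Gmx_pos.
Qed.

(** Substituting the entries of the completion for the variables gives the
completion itself, as it vanishes off the band; then
[inverse_completion_near] applies to its inverse. *)
Lemma polar_after_inverse_polar : exists c d : P, [/\ c != 0, d != 0 &
  forall t, c * tnth (comp_ratmap (polar_map f) inverse_polar) t = d * 'X_t].
Proof.
pose M := completion p X^T.
pose H : 'M[P]_m := rev_cols M.
have MH : M = rev_cols H.
  by apply/matrixP => i j; rewrite [RHS]mxE [H _ _]mxE rev_ordK.
have GH : map_mx (comp_mpoly inverse_polar) G = H.
  rewrite (map_Gmx (H := H)) => [|t]; last first.
    by rewrite /= comp_mpoly_var tnth_mktuple [H _ _]mxE.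
  apply/matrixP => i j; rewrite mxE; case: ifPn => // Hij.
  by rewrite [H _ _]mxE completion_far // nearC -in_band_near rev_ordK.
pose B := rev_rows (\adj H).
have BM : B *m M = (\det H)%:M by rewrite MH mul_rev_adj_rev.
have MB : M *m B = (\det H)%:M by rewrite MH mul_rev_rev_adj.
have E := inverse_completion_near pivot_X_neq0 BM MB.
exists (pivots p X^T), (\det H); split; first exact/pivots_neq0/pivot_X_neq0.
  have := det_completion_neq0 pivot_X_neq0; rewrite -/M MH det_rev_cols.
  by rewrite mulf_eq0 negb_or => /andP [].
move=> t; rewrite tnth_mktuple tnth_polar_map.
have := pos_in_band t; rewrite [pos t]surjective_pairing -{1}[(pos t).2]rev_ordK.
rewrite in_band_near => /E.
rewrite [B _ _]mxE [\adj _ _ _]mxE rev_ordK [X^T _ _]mxE [X _ _]mxE rev_ordK.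
by rewrite Gmx_pos -GH cofactor_map_mx /=.
Qed.

Lemma homaloidal_fdet : homaloidal f.
Proof.
have [t _] : exists t : 'I_n, True.
  have [|t _] := @pos_onto m r r (Ordinal m0, rev_ord (Ordinal m0)); last by exists t.
  by rewrite in_band_near /near leq_addr.
have X0 u : ('X_u : P) != 0 := mpolyXU_neq0 k u.
have idn0 : nonzero_tuple (id_ratmap k n) by exists t; rewrite tnth_mktuple.
have [d d0 GF] := inverse_polar_after_polar.
have [c' [d' [c0' d0' FG]]] := polar_after_inverse_polar.
split; first exact: fdet_homog; split.
  split.
    exists (\sum_(u < m.-1) 1)%N => u; rewrite tnth_polar_map.
    by apply: (dhomog_cofactor (d := fun=> 1%N)) => i j; apply: Gmx_homog.
  exists t; apply: contraNneq (mulf_neq0 d0' (X0 t)) => F0.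
  by rewrite -FG tnth_mktuple F0 rmorph0 mulr0.
exists inverse_polar; split.
- split.
    have homX a b : X^T a b \is 1.-homog.
      by rewrite [X^T _ _]mxE [X _ _]mxE; apply: Gmx_homog.
    have [e He] := dhomog_completion p homX.
    by exists e => u; rewrite tnth_mktuple.
  exists t; apply: contraNneq (mulf_neq0 d0 (X0 t)) => F0.
  by rewrite -GF tnth_mktuple F0 rmorph0 mulr0.
- apply: (same_ratmap_scale fdet_neq0 d0 idn0) => u.
  by rewrite GF tnth_mktuple.
- apply: (same_ratmap_scale c0' d0' idn0) => u.
  by rewrite FG tnth_mktuple.
Qed.

End Polar.

Theorem theorem3p4 (k : fieldType) (m r s : nat)
    (hm : (3 <= m)%N) (hrs : (r <= s)%N) (hs : (s <= m - 2)%N) :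
  (r <> s -> vanishing_hessian (fdet k m r s)) /\
  (r = s -> homaloidal (fdet k m r s)).
Proof.
split=> [/eqP nrs | <-].
  by apply: vanishing_hessian_fdet; rewrite // ltn_neqAle nrs.
by apply: homaloidal_fdet; lia.
Qed.
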